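(* Let $G$ be a countable group. Every pmp action $a$ of $G$ on a diffuse probability space has a standard factor (that is, a factor which is an action on a standard probability space) which is weakly equivalent to $a$. In particular, every pmp action of $G$ is weakly equivalent to an action on a standard Borel probability space.
   Context: A pmp action $a$ of $G$ is an action of $G$ by measure preserving automorphisms of a probability space $(\mathfrak{X}_a,\mu_a)$, not assumed to be standard. A probability space is diffuse if it has no atoms. $\mathrm{MAlg}(\mathfrak{X},\mu)$ denotes the measure algebra (measurable sets modulo null sets). An action $b$ is a factor of $a$ if there is a $G$-invariant (i.e. equivariant) isometric (measure preserving) embedding of $\sigma$-algebras $\mathrm{MAlg}(\mathfrak{X}_b,\mu_b)\hookrightarrow\mathrm{MAlg}(\mathfrak{X}_a,\mu_a)$. Weak containment: $a\prec b$ if for every $\varepsilon>0$, every finite measurable partition $\{A_1,\ldots,A_n\}$ of $\mathfrak{X}_a$ and every finite $F\subset G$ there is a measurable partition $\{B_1,\ldots,B_n\}$ of $\mathfrak{X}_b$ such that $\sum_{i,j\leq n}\sum_{f\in F}|\mu_a(A_i\cap fA_j)-\mu_b(B_i\cap fB_j)|\leq\varepsilon$. The actions $a$ and $b$ are weakly equivalent if $a\prec b$ and $b\prec a$. *)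

(* Defs.v *)
From HB Require Import structures.
From mathcomp Require Import all_boot all_order all_algebra finmap.
From mathcomp Require Import generic_quotient.
From mathcomp Require Import all_classical all_reals all_analysis.

Set Implicit Arguments.
Unset Strict Implicit.
Unset Printing Implicit Defensive.

Import Order.TTheory GRing.Theory Num.Theory.

Local Open Scope classical_set_scope.
Local Open Scope ring_scope.

(* The measure algebra MAlg(X, mu): measurable sets modulo null sets. *)
Section measure_algebra.
Context d (T : measurableType d) (R : realType) (mu : probability T R).
Local Open Scope ereal_scope.
Local Open Scope quotient_scope.

Definition mset : Type := (@measurable d T : set (set T)).

Definition mset_of (A : set T) (mA : measurable A) : mset :=
  exist _ A (mem_set mA).

Lemma mset_measurable (A : mset) : measurable (val A).
Proof. exact: set_valP. Qed.

Definition eq_mod_null (A B : mset) : bool := mu (val A `+` val B) == 0.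

Lemma eq_mod_nullP (A B : mset) :
  eq_mod_null A B <->
  mu (val A `\` val B) = 0 /\ mu (val B `\` val A) = 0.
Proof.
have mA := mset_measurable A; have mB := mset_measurable B.
have mAB : measurable (val A `\` val B) by exact: measurableD.
have mBA : measurable (val B `\` val A) by exact: measurableD.
split=> [/eqP AB0|[A0 B0]].
  split; apply/eqP; rewrite -measure_le0 -AB0;
    apply: le_measure; rewrite ?inE //=; try exact: measurableU.
    by move=> x; left.
  by move=> x; right.
apply/eqP/eqP; rewrite -measure_le0.
by apply: (le_trans (measureU2 _ _ _)) => //; rewrite [X in X + _]A0 [X in _ + X]B0 adde0.
Qed.

Lemma eq_mod_null_refl : reflexive eq_mod_null.
Proof. by move=> A; apply/eq_mod_nullP; rewrite setDv measure0. Qed.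

Lemma eq_mod_null_sym : symmetric eq_mod_null.
Proof. by move=> A B; rewrite /eq_mod_null /setY setUC. Qed.

Lemma eq_mod_null_trans : transitive eq_mod_null.
Proof.
suff D0 (A B C : mset) : mu (val A `\` val B) = 0 ->
    mu (val B `\` val C) = 0 -> mu (val A `\` val C) = 0.
  move=> B A C /eq_mod_nullP[AB BA] /eq_mod_nullP[BC CB].
  by apply/eq_mod_nullP; split; [exact: (D0 _ B)|exact: (D0 _ B)].
have mA := mset_measurable A; have mB := mset_measurable B.
have mC := mset_measurable C.
have mAB : measurable (val A `\` val B) by exact: measurableD.
have mBC : measurable (val B `\` val C) by exact: measurableD.
move=> AB0 BC0; apply/eqP; rewrite -measure_le0.
apply: (@le_trans _ _ (mu ((val A `\` val B) `|` (val B `\` val C)))).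
  apply: le_measure; rewrite ?inE//; [exact: measurableD|exact: measurableU|].
  by move=> x [Ax nCx]; case: (pselect (val B x)) => Bx; [right|left].
by apply: (le_trans (measureU2 _ _ _)) => //; rewrite [X in X + _]AB0 [X in _ + X]BC0 adde0.
Qed.

Canonical eq_mod_null_equiv :=
  EquivRel eq_mod_null eq_mod_null_refl eq_mod_null_sym eq_mod_null_trans.

Definition MAlg : Type := {eq_quot eq_mod_null}.
HB.instance Definition _ := Choice.on MAlg.
HB.instance Definition _ := EqQuotient.on MAlg.

Definition malg_class (A : set T) (mA : measurable A) : MAlg :=
  \pi_MAlg (mset_of mA).

Definition malg_rep (x : MAlg) : set T := val (repr x).

Lemma malg_rep_measurable (x : MAlg) : measurable (malg_rep x).
Proof. exact: mset_measurable. Qed.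

Lemma malg_classP (A B : set T) (mA : measurable A) (mB : measurable B) :
  malg_class mA = malg_class mB <-> mu (A `+` B) = 0.
Proof.
rewrite /malg_class; split=> [/eqP|AB0].
  by rewrite eqmodE => /eqP.
by apply/eqP; rewrite eqmodE; apply/eqP.
Qed.

Lemma malg_rep_class (A : set T) (mA : measurable A) :
  mu (malg_rep (malg_class mA) `+` A) = 0.
Proof.
apply/(malg_classP (malg_rep_measurable _) mA).
rewrite /malg_class -[RHS]reprK; congr (\pi_MAlg _); exact: val_inj.
Qed.

Definition malg_measure (x : MAlg) : \bar R := mu (malg_rep x).

Definition malg_compl (x : MAlg) : MAlg :=
  malg_class (measurableC (malg_rep_measurable x)).

Definition malg_bigcup (x : nat -> MAlg) : MAlg :=
  malg_class (bigcup_measurable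
    (fun n (_ : [set: nat] n) => malg_rep_measurable (x n))).

Lemma malg_measure_class (A : set T) (mA : measurable A) :
  malg_measure (malg_class mA) = mu A.
Proof.
have := malg_rep_class mA; rewrite /malg_measure; set B := malg_rep _ => BA0.
have mB : measurable B by exact: malg_rep_measurable.
have /eq_mod_nullP[/= BA AB] : eq_mod_null (mset_of mB) (mset_of mA).
  exact/eqP.
rewrite (measureDI mu mB mA) (measureDI mu mA mB).
by rewrite [X in X + _ = _]BA [X in _ = X + _]AB setIC.
Qed.

End measure_algebra.

(* The underlying probability space is arbitrary, not assumed standard. *)
Record pmp_action (R : realType) (G : groupType) := PmpAction {
  pmp_display : measure_display ;
  pmp_space : measurableType pmp_display ;
  pmp_mu : probability pmp_space R ;
  pmp_act : G -> pmp_space -> pmp_space ;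
  pmp_act1 : forall x, pmp_act 1%g x = x ;
  pmp_actM : forall g h x, pmp_act (g * h)%g x = pmp_act g (pmp_act h x) ;
  pmp_act_measurable : forall g, measurable_fun setT (pmp_act g) ;
  pmp_act_preserving : forall g (A : set pmp_space), measurable A ->
    pmp_mu (pmp_act g @^-1` A) = pmp_mu A
}.

Section pmp_action_theory.
Context (R : realType) (G : groupType).
Implicit Types a b : pmp_action R G.
Local Open Scope ereal_scope.

Lemma pmp_act_image a (g : G) (A : set (pmp_space a)) :
  pmp_act g @` A = pmp_act g^-1%g @^-1` A.
Proof.
apply/seteqP; split=> [_ [x Ax <-]|x Ax].
  by rewrite /preimage /= -pmp_actM mulVg pmp_act1.
by exists (pmp_act g^-1%g x) => //; rewrite -pmp_actM mulgV pmp_act1.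
Qed.

Lemma pmp_act_image_measurable a (g : G) (A : set (pmp_space a)) :
  measurable A -> measurable (pmp_act g @` A).
Proof.
move=> mA; rewrite pmp_act_image -[X in measurable X]setTI.
exact: pmp_act_measurable.
Qed.

Definition malg_act a (g : G) (x : MAlg (pmp_mu a)) : MAlg (pmp_mu a) :=
  malg_class (pmp_mu a) (pmp_act_image_measurable g (malg_rep_measurable x)).

Lemma malg_act_class a (g : G) (A : set (pmp_space a)) (mA : measurable A) :
  malg_act g (malg_class (pmp_mu a) mA) =
  malg_class (pmp_mu a) (pmp_act_image_measurable g mA).
Proof.
apply/malg_classP; have := malg_rep_class (pmp_mu a) mA.
set B := malg_rep _ => BA0; rewrite !pmp_act_image.
have mB : measurable B by exact: malg_rep_measurable.
rewrite -[RHS]BA0.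
have mBA : measurable (B `+` A) by apply: measurableU; exact: measurableD.
exact: (pmp_act_preserving g^-1%g mBA).
Qed.

(* The embedding is a map of sigma-algebras: it commutes with complements and
   countable unions, hence with all the other Boolean operations. *)
Definition pmp_factor b a :=
  exists Phi : MAlg (pmp_mu b) -> MAlg (pmp_mu a),
    [/\ injective Phi,
        forall x, Phi (malg_compl x) = malg_compl (Phi x),
        forall x : nat -> MAlg (pmp_mu b),
          Phi (malg_bigcup x) = malg_bigcup (Phi \o x),
        forall x, malg_measure (Phi x) = malg_measure x
      & forall g x, Phi (malg_act g x) = malg_act g (Phi x)].

(* Some pieces may be empty. *)
Definition finite_measurable_partition d (T : measurableType d) n
    (A : 'I_n -> set T) :=
  [/\ forall i, measurable (A i), trivIset setT A & cover setT A = setT].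

Definition weakly_contained a b :=
  forall (eps : R) (n : nat) (A : 'I_n -> set (pmp_space a)) (F : {fset G}),
    (0 < eps)%R -> finite_measurable_partition A ->
    exists2 B : 'I_n -> set (pmp_space b), finite_measurable_partition B &
      \sum_(i < n) \sum_(j < n) \sum_(f <- F)
        `| pmp_mu a (A i `&` pmp_act f @` A j)
           - pmp_mu b (B i `&` pmp_act f @` B j) | <= eps%:E.

Definition weakly_equivalent a b :=
  weakly_contained a b /\ weakly_contained b a.

End pmp_action_theory.

Definition atom d (T : measurableType d) (R : realType) (mu : probability T R)
    (A : set T) :=
  [/\ measurable A, (0 < mu A)%E &
      forall B, measurable B -> B `<=` A -> mu B = 0%E \/ mu B = mu A].

Definition diffuse d (T : measurableType d) (R : realType)
    (mu : probability T R) := ~ exists A, atom mu A.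

(* T is isomorphic to a Polish space P (complete, Hausdorff and
   second-countable) equipped with its Borel sigma-algebra. *)
Definition standard_borel (R : realType) d (T : measurableType d) :=
  exists (P : completePseudoMetricType R) (f : T -> P),
    [/\ hausdorff_space P, @second_countable P, bijective f &
        forall A : set T, measurable A <-> <<s [set U : set P | open U] >> (f @` A)].

(* Main.v *)
Require Import Defs.
From HB Require Import structures.
From mathcomp Require Import all_boot all_order all_algebra.
From mathcomp Require Import lra.
From mathcomp Require Import all_classical all_reals all_analysis.

Set Implicit Arguments.
Unset Strict Implicit.
Unset Printing Implicit Defensive.

Import Order.TTheory GRing.Theory Num.Theory.

Local Open Scope classical_set_scope.
Local Open Scope ring_scope.

(** Record the joint law of a finite coloring u : X -> {0, .., n} by the numbers
    mu(u = i /\ g(u = j)). These data live in a separable space, so for every n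
    countably many measurable colorings c_(n,k) realize them up to any error.
    The itinerary map x |-> (c_(n,k)(g^-1 x))_(n,k,g), with values in
    nat^(nat * nat * G), is equivariant for the shift, hence a factor map onto its
    law, and each coloring c_(n,k) is read off the coordinate (n, k, 1). So the
    law of the itinerary weakly contains the given action. *)

(** * Topology of [nat^I] for countable [I] *)

Definition baire (R : realType) (I : countType) : Type := I -> nat.

Section baire_topology.
Context (R : realType) (I : countType).
Local Notation B := (baire R I).

(* The radius is required to be positive because the triangle inequality of the
   pseudometric interface quantifies over arbitrary radii. *)
Definition baire_ball (x : B) (e : R) (y : B) : Prop :=
  0 < e /\ forall i, e <= (pickle i).+1%:R^-1 -> x i = y i.

Let ball_center (x : B) e : 0 < e -> baire_ball x e x.
Proof. by split. Qed.

Let ball_sym (x y : B) e : baire_ball x e y -> baire_ball y e x.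
Proof. by move=> [e0 xy]; split=> // i /xy. Qed.

Let ball_triangle (x y z : B) e1 e2 :
  baire_ball x e1 y -> baire_ball y e2 z -> baire_ball x (e1 + e2) z.
Proof.
move=> [e10 xy] [e20 yz]; split=> [|i ei]; first exact: addr_gt0.
rewrite xy ?yz//; apply: le_trans ei; first by rewrite lerDr ltW.
by rewrite lerDl ltW.
Qed.

HB.instance Definition _ := Choice.copy B (I -> nat).
HB.instance Definition _ := isPointed.Build B (fun=> 0%N).
HB.instance Definition _ := hasNbhs.Build B (nbhs_ (entourage_ baire_ball)).
HB.instance Definition _ := Nbhs_isPseudoMetric.Build R B
  erefl ball_center ball_sym ball_triangle erefl.

Lemma baire_cauchy_cvg (F : set_system B) : ProperFilter F -> cauchy F -> cvg F.
Proof.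
move=> PF /cauchyP cF.
have inv_gt0 n : 0 < (n.+1%:R : R)^-1 by rewrite invr_gt0 ltr0n.
have /choice[x Fx] n : exists x : B, F (ball x n.+1%:R^-1) by exact: cF.
(* A ball of radius [1 / (pickle i + 1)] fixes coordinate [i], so the center of an [F]-large ball of
   that radius already has the value of the limit there. *)
apply/cvg_ex; exists (fun i => x (pickle i) i) => A /nbhs_ballP[e /= e0 eA].
have [y Fy] := cF e e0; apply: filterS (Fy) => z [_ yz].
apply: eA; split=> // i ei.
rewrite -yz//.
have [w [[_ yw] [_ xw]]] := filter_ex (filterI Fy (Fx (pickle i))).
by rewrite yw// xw.
Qed.

HB.instance Definition _ := Uniform_isComplete.Build B baire_cauchy_cvg.

(* Entries of p.2 missing below the index p.1 read as 0. *)
Definition cylinder (p : nat * seq nat) : set B :=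
  [set y | forall i, (pickle i < p.1)%N -> y i = nth 0%N p.2 (pickle i)].

(** Cylinders have codes in the countable type [nat * seq nat], so they give a countable base and
    write every open set as a countable union. *)
Lemma nbhs_baireP (x : B) (A : set B) :
  nbhs x A <-> exists p, cylinder p x /\ cylinder p `<=` A.
Proof.
split=> [/nbhs_ballP[e /= e0 eA]|[[n s] [/= xs sA]]]; last first.
  apply/nbhs_ballP; exists n.+1%:R^-1 => [|y [_ xy]].
    by rewrite /= invr_gt0.
  apply: sA => i /= ni; rewrite -xs// -xy// lef_pV2 ?posrE ?ltr0n// ler_nat.
  exact: leqW.
(* The bound [e <= 1 / (pickle i + 1)] forces [pickle i < n + 1], so agreement below [n + 1] is
   enough. Numbers that code no index get the default 0 in [s]. *)
pose n := Num.truncn e^-1.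
pose s := mkseq (fun k => oapp x 0%N (unpickle k : option I)) n.+1.
have xs i : (pickle i < n.+1)%N -> x i = nth 0%N s (pickle i).
  by move=> lti; rewrite nth_mkseq// pickleK.
exists (n.+1, s); split=> // y ys; apply: eA; split=> // i ei.
suff lti : (pickle i < n.+1)%N by rewrite xs// (ys i).
rewrite -(ltr_nat R); apply: le_lt_trans (truncnS_gt e^-1).
apply: (@le_trans _ _ (pickle i).+1%:R); first by rewrite ler_nat.
by rewrite -[leLHS]invrK lef_pV2// posrE invr_gt0.
Qed.

Lemma open_cylinder p : open (cylinder p).
Proof.
rewrite openE => x xp; rewrite /interior /=; apply/nbhs_baireP.
by exists p; split.
Qed.

Lemma open_coord i n : open [set y : B | y i = n].
Proof.
rewrite openE => x xi; rewrite /interior /=; apply/nbhs_ballP.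
exists (pickle i).+1%:R^-1 => [|y [_ xy]]; first by rewrite /= invr_gt0.
by rewrite /= -xi xy.
Qed.

Lemma baire_hausdorff : hausdorff_space B.
Proof.
move=> x y xy; apply/funext => i.
have nx (w : B) : nbhs w [set z : B | z i = w i].
  by apply: open_nbhs_nbhs; split=> //; exact: open_coord.
by have [z [/= <- <-]] := xy _ _ (nx x) (nx y).
Qed.

Lemma baire_second_countable : @second_countable B.
Proof.
exists (range cylinder).
  by apply: (sub_countable (card_image_le cylinder setT)).
split=> [_ [p _ <-]|x A /nbhs_baireP[p [xp pA]]]; first exact: open_cylinder.
by exists (cylinder p) => //; split=> //; exists p.
Qed.

End baire_topology.

(** * Borel structure of [nat^I] *)

Section baire_measurable.
Context (R : realType) (I : countType).

Definition borel_baire : Type := g_sigma_algebraType (@open (baire R I)).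
HB.instance Definition _ := Measurable.on borel_baire.

Lemma standard_borel_baire : standard_borel R borel_baire.
Proof.
exists (baire R I), id; split.
- exact: baire_hausdorff.
- exact: baire_second_countable.
- by exists id.
- by move=> A; rewrite image_id.
Qed.

Lemma measurable_coord i n : measurable [set y : borel_baire | y i = n].
Proof. by apply: sub_sigma_algebra; exact: open_coord. Qed.

(** A cylinder is a countable intersection of coordinate conditions, an open set is a countable
    union of cylinders, and open sets generate. *)
Lemma measurable_fun_baire d (T : measurableType d) (f : T -> borel_baire) :
  (forall i n, measurable [set x | f x i = n]) -> measurable_fun setT f.
Proof.
move=> mf.
have mcyl p : measurable (f @^-1` @cylinder R I p).
  (* A [k] that codes no index, or is at least [p.1], imposes no condition. *)
  rewrite (_ : _ @^-1` _ = \bigcap_k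
      [set x | forall i : I, pickle i = k -> (k < p.1)%N ->
                             f x i = nth 0%N p.2 k]).
    apply: bigcapT_measurable => k.
    have [[i ik]|nik] := pselect (exists i : I, pickle i = k); last first.
      rewrite (_ : [set _ | _] = setT)//; apply/seteqP; split=> // x _ i ik.
      by case: nik; exists i.
    have [kp|kp] := ltnP k p.1; last first.
      by rewrite (_ : [set _ | _] = setT)//; apply/seteqP; split=> // x _ j _.
    rewrite (_ : [set _ | _] = [set x | f x i = nth 0%N p.2 k])//.
    apply/seteqP; split=> [x /(_ i ik erefl)//|x fx j jk _].
    by rewrite -fx; congr (f x _); apply: (pcan_inj pickleK); rewrite ik.
  apply/seteqP; split=> [x fx _ _ i <- ip|x fx i ip]; first exact: fx.
  exact: (fx (pickle i)).
apply: (measurability (@open (baire R I) : set (set borel_baire))) => //.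
move=> _ [U oU <-].
rewrite setTI; have -> : f @^-1` U =
    \bigcup_(p in [set p | @cylinder R I p `<=` U]) f @^-1` @cylinder R I p.
  apply/seteqP; split=> [x Ux|x [p pU /pU]//].
  have /nbhs_baireP[p [fp pU]] : nbhs (f x : baire R I) U.
    exact: open_nbhs_nbhs.
  by exists p.
rewrite bigcup_mkcond; apply: countable_bigcupT_measurable => [|p].
  exact: countableP.
by case: ifP.
Qed.

End baire_measurable.

(** * Measure algebras and factor maps *)

Section measure_algebra_operations.
Context d (T : measurableType d) (R : realType) (mu : probability T R).

Lemma malg_class_rep (x : MAlg mu) : malg_class mu (malg_rep_measurable x) = x.
Proof.
by rewrite /malg_class -[RHS]reprK; congr (\pi_(MAlg mu) _)%qT; exact: val_inj.
Qed.

Lemma malg_class_eq (A B : set T) (mA : measurable A) (mB : measurable B) :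
  A = B -> malg_class mu mA = malg_class mu mB.
Proof. by move=> AB; apply/malg_classP; rewrite AB setYK measure0. Qed.

Lemma malg_compl_class (A : set T) (mA : measurable A) :
  malg_compl (malg_class mu mA) = malg_class mu (measurableC mA).
Proof.
apply/malg_classP; rewrite -[RHS](malg_rep_class mu mA); congr (mu _).
by rewrite /setY !setDE !setCK setUC (setIC (~` A)) (setIC _ A).
Qed.

(** The symmetric difference of two unions lies in the union of the symmetric differences, a
    countable union of null sets. *)
Lemma malg_bigcup_class (A : nat -> set T) (mA : forall n, measurable (A n)) :
  malg_bigcup (fun n => malg_class mu (mA n)) =
  malg_class mu (bigcup_measurable (fun n (_ : [set: nat] n) => mA n)).
Proof.
pose B n := malg_rep (malg_class mu (mA n)).
have mB n : measurable (B n) by exact: malg_rep_measurable.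
have mY (C D : set T) : measurable C -> measurable D -> measurable (C `+` D).
  by move=> mC mD; apply: measurableU; exact: measurableD.
apply/malg_classP; apply/negligibleP.
  by apply: mY; exact: bigcupT_measurable.
apply: (@negligibleS _ _ _ mu (\bigcup_n (B n `+` A n))).
  move=> x [[[n _ Bx] nA]|[[n _ Ax] nB]]; exists n => //; [left|right].
    by split=> // Ax; apply: nA; exists n.
  by split=> // Bx; apply: nB; exists n.
apply: negligible_bigcup => n; apply/negligibleP; first exact: mY.
exact: malg_rep_class.
Qed.

End measure_algebra_operations.

Lemma preimage_act_image (R : realType) (G : groupType) (a b : pmp_action R G)
    (p : pmp_space a -> pmp_space b) :
    (forall g x, p (pmp_act g x) = pmp_act g (p x)) ->
  forall g A, p @^-1` (pmp_act g @` A) = pmp_act g @` (p @^-1` A).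
Proof.
move=> pE g A; rewrite !pmp_act_image.
by apply/seteqP; split=> x; rewrite /preimage /= pE.
Qed.

Section factor_map.
Context (R : realType) (G : groupType) (a b : pmp_action R G).
Context (p : pmp_space a -> pmp_space b).
Hypothesis p_meas : measurable_fun setT p.
Hypothesis p_pres : forall A, measurable A -> pmp_mu a (p @^-1` A) = pmp_mu b A.
Hypothesis p_equiv : forall g x, p (pmp_act g x) = pmp_act g (p x).

Let preimage_measurable A : measurable A -> measurable (p @^-1` A).
Proof. by move=> mA; rewrite -[X in measurable X]setTI; exact: p_meas. Qed.

Let Phi (x : MAlg (pmp_mu b)) : MAlg (pmp_mu a) :=
  malg_class (pmp_mu a) (preimage_measurable (malg_rep_measurable x)).

(** Null sets pull back to null sets, so the representative picked by [Phi] does not matter and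
    identities can be checked on sets. *)
Let PhiE A (mA : measurable A) :
  Phi (malg_class (pmp_mu b) mA) =
  malg_class (pmp_mu a) (preimage_measurable mA).
Proof.
apply/malg_classP; have := malg_rep_class (pmp_mu b) mA.
set B := malg_rep _ => BA0.
have mB : measurable B by exact: malg_rep_measurable.
by rewrite -[RHS]BA0 -p_pres//; apply: measurableU; exact: measurableD.
Qed.

Lemma factor_map_pmp_factor : pmp_factor b a.
Proof.
exists Phi; split=> [x y xy|x|x|x|g x].
- rewrite -(malg_class_rep x) -(malg_class_rep y); apply/malg_classP.
  rewrite -p_pres; first by move/malg_classP : xy.
  by apply: measurableU; apply: measurableD; exact: malg_rep_measurable.
- by rewrite PhiE malg_compl_class; exact: malg_class_eq.
- by rewrite PhiE malg_bigcup_class; apply: malg_class_eq; rewrite preimage_bigcup.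
- by rewrite malg_measure_class p_pres//; exact: malg_rep_measurable.
- by rewrite PhiE malg_act_class; apply: malg_class_eq; exact: preimage_act_image.
Qed.

(** Pulling a partition back along [p] reproduces its joint measures exactly, so every term of the
    sum vanishes. *)
Lemma factor_map_weakly_contained : weakly_contained b a.
Proof.
move=> eps n A F eps0 [mA tA cA]; exists (fun i => p @^-1` A i).
  split=> [i|i j _ _ [x [Aix Ajx]]|]; first exact: preimage_measurable.
    by apply: tA => //; exists (p x).
  rewrite /cover -preimage_bigcup -[X in p @^-1` X]/(cover setT A) cA.
  exact: preimage_setT.
rewrite big1 ?lee_fin ?ltW// => i _; rewrite big1// => j _; rewrite big1// => f _.
have mAf : measurable (A i `&` pmp_act f @` A j).
  by apply: measurableI => //; exact: pmp_act_image_measurable.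
rewrite -preimage_act_image// -preimage_setI p_pres// subee ?abse0//.
exact: fin_num_measure.
Qed.

End factor_map.

(* Pigeonhole on the integer parts of the (m + 1) f s j, for j in D: one s is
   chosen for each of the countably many possible codes. *)
Lemma countable_approximation (R : realType) (S : Type) (P : set S)
    (J : countType) (f : S -> J -> R) : P !=set0 ->
  exists2 u : nat -> S, (forall k, P (u k)) &
    forall s (D : seq J) (e : R), P s -> 0 < e ->
      exists k, forall j, j \in D -> `|f s j - f (u k) j| < e.
Proof.
move=> [s0 Ps0].
pose code s (D : seq J) (m : nat) := [seq Num.floor (f s j * m.+1%:R) | j <- D].
have /choice[v Pv] (q : seq J * nat * seq int) : exists s, P s /\
    forall t, P t -> code t q.1.1 q.1.2 = q.2 -> code s q.1.1 q.1.2 = q.2.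
  (* If no element of [P] has the code [q.2], the default [s0] satisfies the implication
     vacuously. *)
  have [[s [Ps sq]]|nq] := pselect (exists s, P s /\ code s q.1.1 q.1.2 = q.2).
    by exists s.
  by exists s0; split=> // t Pt tq; case: nq; exists t.
exists (fun k => oapp v s0 (unpickle k)) => [k|s D e Ps e0].
  by case: unpickle => //= q; have [] := Pv q.
(* Here [1 / (m + 1) < e], and numbers with the same integer part differ by less than 1, so equal
   codes at scale [m + 1] give an error below [e]. *)
pose m := Num.truncn e^-1.
exists (pickle (D, m, code s D m)) => j jD; rewrite pickleK /=.
have [_ /(_ s Ps erefl)/eq_in_map/(_ j jD)] := Pv (D, m, code s D m).
set w := v _ => /= fl.
have m0 : 0 < m.+1%:R :> R by rewrite ltr0n.
rewrite -(ltr_pM2r m0) -[X in _ * X < _]gtr0_norm// -normrM mulrBl.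
apply: (@lt_le_trans _ _ 1); last first.
  by rewrite -ler_pdivrMl// mulr1 ltW// truncnS_gt.
have := floor_itv (f s j * m.+1%:R); have := floor_itv (f w j * m.+1%:R).
rewrite fl ltr_norml.
lra.
Qed.

(** * The symbolic model of the action *)

Section symbolic_model.
Context (R : realType) (G : groupType) (Gc : countType) (a : pmp_action R G).
(* Gc is G with an enumeration of its elements. *)
Context (val_G : Gc -> G) (num_G : G -> Gc).
Hypothesis num_GK : cancel num_G val_G.
Hypothesis val_GK : cancel val_G num_G.

Definition joint_law (u : pmp_space a -> nat) (t : nat * nat * Gc) : R :=
  fine (pmp_mu a ([set x | u x = t.1.1] `&`
                  pmp_act (val_G t.2) @` [set x | u x = t.1.2])).

(** There are [n + 1] colors. Taking them in [nat] lets the colorings for all [n] serve as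
    coordinates of one space. *)
Definition coloring (n : nat) : set (pmp_space a -> nat) :=
  [set u | (forall i, measurable [set x | u x = i]) /\ forall x, (u x <= n)%N].

Lemma dense_colorings : exists2 c : nat -> nat -> pmp_space a -> nat,
  (forall n k, coloring n (c n k)) &
  forall n u (D : seq (nat * nat * Gc)) (e : R), coloring n u -> 0 < e ->
    exists k, forall t, t \in D -> `|joint_law u t - joint_law (c n k) t| < e.
Proof.
have /choice[c cP] n : exists v : nat -> pmp_space a -> nat,
    (forall k, coloring n (v k)) /\
    forall u (D : seq (nat * nat * Gc)) (e : R), coloring n u -> 0 < e ->
      exists k, forall t, t \in D -> `|joint_law u t - joint_law (v k) t| < e.
  have [|v] := @countable_approximation R _ (coloring n) _ joint_law.
    exists (fun=> 0%N); split=> // -[|i].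
      by rewrite (_ : [set _ | _] = setT)//; apply/seteqP.
    by rewrite (_ : [set _ | _] = set0)//; apply/seteqP; split=> x.
  by exists v.
by exists c => n; have [] := cP n.
Qed.

Context (c : nat -> nat -> pmp_space a -> nat).
Hypothesis c_coloring : forall n k, coloring n (c n k).
Hypothesis c_dense : forall n u (D : seq (nat * nat * Gc)) (e : R),
  coloring n u -> 0 < e ->
  exists k, forall t, t \in D -> `|joint_law u t - joint_law (c n k) t| < e.

Local Notation I := (nat * nat * Gc)%type.
Local Notation Y := (borel_baire R I).

Definition itinerary (x : pmp_space a) : Y :=
  fun i => c i.1.1 i.1.2 (pmp_act (val_G i.2)^-1%g x).

Definition shift (g : G) (y : Y) : Y :=
  fun i => y (i.1, num_G (g^-1 * val_G i.2)%g).

Lemma measurable_itinerary : measurable_fun setT itinerary.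
Proof.
apply: measurable_fun_baire => i m.
rewrite -[X in measurable X]setTI.
have [mc _] := c_coloring i.1.1 i.1.2.
exact: (pmp_act_measurable (val_G i.2)^-1%g measurableT (mc m)).
Qed.

(** At group coordinate [h], both sides evaluate a coloring at [h^-1 g x], since
    [(g^-1 h)^-1 = h^-1 g]. *)
Lemma itinerary_act g x : itinerary (pmp_act g x) = shift g (itinerary x).
Proof.
by apply/funext => i; rewrite /shift /itinerary num_GK invgM invgK pmp_actM.
Qed.

Lemma shift1 y : shift 1%g y = y.
Proof. by apply/funext => -[i g]; rewrite /shift invg1 mul1g val_GK. Qed.

Lemma shiftM g h y : shift (g * h)%g y = shift g (shift h y).
Proof. by apply/funext => i; rewrite /shift /= num_GK invgM mulgA. Qed.

Lemma measurable_shift g : measurable_fun setT (shift g).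
Proof. by apply: measurable_fun_baire => i m; exact: measurable_coord. Qed.

Definition itinerary_mfun : {mfun pmp_space a >-> Y} :=
  mfun_Sub (mem_set measurable_itinerary).

Definition itinerary_law : probability Y R :=
  distribution (pmp_mu a) itinerary_mfun.

Lemma itinerary_lawE A : itinerary_law A = pmp_mu a (itinerary @^-1` A).
Proof. by []. Qed.

Lemma shift_preserving g A : measurable A ->
  itinerary_law (shift g @^-1` A) = itinerary_law A.
Proof.
move=> mA; rewrite !itinerary_lawE -[RHS](pmp_act_preserving g).
  congr (pmp_mu a _).
  by apply/seteqP; split=> x; rewrite /preimage /= itinerary_act.
by rewrite -[X in measurable X]setTI; exact: measurable_itinerary.
Qed.

Definition symbolic_action : pmp_action R G :=
  PmpAction shift1 shiftM measurable_shift shift_preserving.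

Lemma weakly_contained_symbolic_action : weakly_contained a symbolic_action.
Proof.
move=> e [|n] A F e0 [mA tA cA].
  (* A partition into no pieces cannot cover a space that contains [point]. *)
  have : cover setT A point by rewrite cA.
  by move=> [[m]].
have /choice[u uA] x : exists i, A i x.
  have : cover setT A x by rewrite cA.
  by move=> [i _ Aix]; exists i.
have Au i : A i = [set x | u x = i].
  apply/seteqP; split=> x; last by move=> <-.
  by move=> Aix; apply: tA => //; exists x.
have Ain i : A i = [set x | nat_of_ord (u x) = i].
  by rewrite Au; apply/seteqP; split=> x /= => [->//|/ord_inj].
have u_col : coloring n (fun x => u x).
  split=> [i|x]; last by rewrite -ltnS.
  have [ni|ni] := ltnP i n.+1; last first.
    rewrite (_ : [set _ | _] = set0)//; apply/seteqP; split=> // x /= ui.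
    by move: ni; rewrite -ui leqNgt ltn_ord.
  by rewrite -(Ain (Ordinal ni)).
(* [N] counts the terms of the triple sum and [D] lists their indices. Each term is allowed the
   error [e / (N + 1)]; the successor avoids a division by 0 when [F] is empty. *)
pose Fs := finmap.enum_fset F; pose N := (size Fs * n.+1 * n.+1)%N.
pose ijs := [seq (i, j) | i <- iota 0 n.+1, j <- iota 0 n.+1].
pose D := [seq (q, num_G f) | q <- ijs, f <- Fs].
have d0 : 0 < e / N.+1%:R by rewrite divr_gt0.
have [k uk] := c_dense D u_col d0.
(* inord is the identity on the values of c n k, and makes B a partition of all
   of Y, not only of the range of the itinerary map. *)
pose B (i : 'I_n.+1) : set Y := [set y | inord (y (n, k, num_G 1%g)) = i].
have mB i : measurable (B i).
  rewrite (_ : B i = \bigcup_m (if inord m == i then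
      [set y : Y | y (n, k, num_G 1%g) = m] else set0)).
    apply: bigcupT_measurable => m.
    by case: ifP => // _; exact: measurable_coord.
  apply/seteqP; split=> [y /= By|y [m _]].
    by exists (y (n, k, num_G 1%g)) => //; rewrite By eqxx.
  by case: ifPn => // /eqP mi /= ym; rewrite /B /= ym.
have cB i : itinerary @^-1` B i = [set x | c n k x = i].
  apply/seteqP; split=> x;
      rewrite /B /preimage /itinerary /= num_GK invg1 pmp_act1.
    by move=> <-; rewrite inordK// ltnS (c_coloring n k).2.
  by move=> ->; rewrite inord_val.
exists B.
  split=> //; first by move=> i j _ _ [y [<- <-]].
  by apply/seteqP; split=> // y _; exists (inord (y (n, k, num_G 1%g))).
apply: (@le_trans _ _ (\sum_(i < n.+1) \sum_(j < n.+1) \sum_(f <- Fs)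
                          (e / N.+1%:R)%:E)%E).
  apply: lee_sum => i _; apply: lee_sum => j _.
  rewrite big_seq [leRHS]big_seq; apply: lee_sum => f fF.
  have tD : (nat_of_ord i, nat_of_ord j, num_G f) \in D.
    by apply: allpairs_f => //; apply: allpairs_f; rewrite mem_iota /= add0n.
  have := uk _ tD; rewrite /joint_law /= num_GK -!Ain.
  rewrite (_ : pmp_mu symbolic_action _ =
      pmp_mu a ([set x | c n k x = i] `&` pmp_act f @` [set x | c n k x = j])).
    have fin_joint (C C' : set (pmp_space a)) :
        measurable C -> measurable C' ->
        pmp_mu a (C `&` pmp_act f @` C') \is a fin_num.
      move=> m1 m2; apply: fin_num_measure; apply: measurableI => //.
      exact: pmp_act_image_measurable.
    rewrite -[in leLHS](fineK (fin_joint _ _ (mA i) (mA j))).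
    have [mc _] := c_coloring n k.
    rewrite -[X in (_ - X)%E](fineK (fin_joint _ _ (mc i) (mc j))).
    by rewrite -EFinB abse_EFin lee_fin => /ltW.
  (* The law measures a set through its preimage, and equivariance turns translates of [B j] into
     translates of color classes. *)
  rewrite -[LHS]/(pmp_mu a (itinerary @^-1`
    (B i `&` @pmp_act _ _ symbolic_action f @` B j))).
  rewrite preimage_setI (preimage_act_image (b := symbolic_action)) ?cB//.
  exact: itinerary_act.
rewrite (_ : (\sum_(i < n.+1) _)%E =
    (\sum_(i < n.+1) \sum_(j < n.+1) \sum_(f <- Fs) e / N.+1%:R)%:E).
  rewrite lee_fin !sumr_const !card_ord big_const_seq count_predT iter_addr addr0.
  rewrite -!mulrnA mulnA -/N -[leLHS]mulr_natr mulrAC ler_pdivrMr// ler_pM2l//.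
  by rewrite ler_nat leqnSn.
rewrite -sumEFin; apply: eq_bigr => i _.
rewrite -sumEFin; apply: eq_bigr => j _.
by rewrite -sumEFin.
Qed.

End symbolic_model.

(** Supplies the [countType] that indexes the group coordinates; it stays apart from [G], which
    already carries the choice structure of its group type. *)
Lemma countable_bijection (T : Type) : countable [set: T] ->
  exists (U : countType) (f : U -> T) (g : T -> U), cancel g f /\ cancel f g.
Proof. by case/Pcountable => U ->; exists U, id, id. Qed.

Lemma standard_weakly_equivalent_factor (R : realType) (G : groupType)
    (a : pmp_action R G) : countable [set: G] ->
  exists b : pmp_action R G,
    [/\ standard_borel R (pmp_space b), pmp_factor b a & weakly_equivalent b a].
Proof.
move=> /countable_bijection[Gc [val_G [num_G [num_GK val_GK]]]].
have [c c_coloring c_dense] := dense_colorings a val_G.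
pose b := symbolic_action num_GK val_GK c_coloring; exists b.
have p_meas := measurable_itinerary val_G c_coloring.
have p_equiv := itinerary_act num_GK c.
split; first exact: standard_borel_baire.
  (* The measure of [b] is by definition the image of that of [a] under the itinerary map, so
     [erefl] proves that this map preserves measure. *)
  exact: (factor_map_pmp_factor (b := b) p_meas (fun _ _ => erefl) p_equiv).
split; last exact: weakly_contained_symbolic_action.
exact: (factor_map_weakly_contained (b := b) p_meas (fun _ _ => erefl) p_equiv).
Qed.

Theorem theorem2p15 (R : realType) (G : groupType) (hG : countable [set: G]) :
  (forall a : pmp_action R G, diffuse (pmp_mu a) ->
     exists b : pmp_action R G,
       [/\ standard_borel R (pmp_space b), pmp_factor b a & weakly_equivalent b a])
  /\
  (forall a : pmp_action R G,
     exists b : pmp_action R G,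
       standard_borel R (pmp_space b) /\ weakly_equivalent a b).
Proof.
split=> a; first by move=> _; exact: standard_weakly_equivalent_factor.
have [b [bstd _ [ba ab]]] := standard_weakly_equivalent_factor a hG.
by exists b.
Qed.
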